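(* Fix an integer $d\ge 2$. Let $c_1,\dots,c_{2d-2}$ be distinct points of $\mathbb C$, and let $A_1,\dots,A_{2d-2}$ be $2d-2$ unknown complex numbers. For $i=1,\dots,2d-2$ and integers $m\ge 0$, set $$L_i=3A_i^2-4\sum_{j\ne i}\frac{A_j(c_i-c_j)+1}{(c_i-c_j)^2},\qquad E_{m+1}=\sum_{i=1}^{2d-2}\bigl(mc_i^{m-1}+c_i^mA_i\bigr).$$ Then the following four problems have the identical set of solutions $(A_1,\dots,A_{2d-2})\in\mathbb C^{2d-2}$: (1) $\displaystyle -\frac32\sum_{i=1}^{2d-2}\frac{A_i(z-c_i)+1}{(z-c_i)^2}$ is equal to $S_f$ with $f$ a rational map of degree $d$; (2) $L_i=0$ for $i=1,\dots,2d-2$, and $E_{m+1}=0$ for $m=0,1,2$; (3) $L_i=0$ for $i=1,\dots,2d-3$, and $E_{m+1}=0$ for $m=0,1,2$; (4) $L_i=0$ for $i=1,\dots,2d-2$, and $E_{m+1}=0$ for $m=0,1$. In this case $f$ has simple critical points at $c_i$, $i=1,\dots,2d-2$ (and a regular point at $\infty$).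
   Context: For a non-constant meromorphic function $f$, $S_f=\frac{f'''}{f'}-\frac32\left(\frac{f''}{f'}\right)^2$ is its Schwarzian derivative (extended by continuity to points where $f=\infty$). Conventions: for $m=0$ the term $mc_i^{m-1}$ is $0$, and $c_i^0=1$. ''Regular point at $\infty$'' means that $\infty$ is not a critical point of $f$. *)

(* Defs.v *)
From mathcomp Require Import all_boot all_order all_algebra.
From mathcomp Require Import generic_quotient ring.

Set Implicit Arguments.
Unset Strict Implicit.
Unset Printing Implicit Defensive.

Import GRing.Theory.
Local Open Scope ring_scope.
Local Open Scope quotient_scope.

Notation "x %:F" := (@FracField.tofrac _ x) : ring_scope.

(* Rational functions over a field F are elements of the field of fractions
   {fraction {poly F}}.  Equality there is equality of rational functions, so
   values at removable singularities need no separate treatment. *)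

Section RationalFunctions.

Variable F : fieldType.
Implicit Types (f g : {fraction {poly F}}) (p q : {poly F}) (a : F).

Definition ratnum f : {poly F} :=
  \n_(repr f) %/ gcdp \n_(repr f) \d_(repr f).

Definition ratden f : {poly F} :=
  \d_(repr f) %/ gcdp \n_(repr f) \d_(repr f).

Definition ratdeg f : nat := maxn (size (ratnum f)).-1 (size (ratden f)).-1.

Definition ratderiv f : {fraction {poly F}} :=
  ((ratnum f)^`() * ratden f - ratnum f * (ratden f)^`())%:F
    / ((ratden f) ^+ 2)%:F.

Definition ratcomp f g : {fraction {poly F}} :=
  (map_poly (fun x : F => x%:P%:F) (ratnum f)).[g]
    / (map_poly (fun x : F => x%:P%:F) (ratden f)).[g].

Definition schwarzian f : {fraction {poly F}} :=
  let f1 := ratderiv f in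
  let f2 := ratderiv f1 in
  let f3 := ratderiv f2 in
  f3 / f1 - 3 / 2 * (f2 / f1) ^+ 2.

(* Multiplicity of a as a critical point of a non-constant f : the order of
   vanishing at a of the derivative of f or, if f has a pole at a, of 1/f. *)
Definition crit_mult f a : nat :=
  let g := if root (ratden f) a then f^-1 else f in
  mup a (ratnum (ratderiv g)).

Definition simple_critical_point f a : Prop := crit_mult f a = 1%N.

(* In the local coordinate 1/z at infinity. *)
Definition regular_at_infinity f : Prop :=
  crit_mult (ratcomp f ('X%:F)^-1) 0 = 0%N.

Lemma ratden_neq0 f : ratden f != 0.
Proof.
have d0 : \d_(repr f) != 0 by exact: denom_ratioP.
by rewrite /ratden dvdp_div_eq0 ?dvdp_gcdr.
Qed.

Lemma coprime_ratnum_ratden f : coprimep (ratnum f) (ratden f).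
Proof.
apply: coprimep_div_gcd; apply/orP; right; exact: denom_ratioP.
Qed.

Lemma frac_divE (p q p' q' : {poly F}) : q != 0 -> q' != 0 ->
  (p%:F / q%:F == p'%:F / q'%:F) = (p * q' == p' * q).
Proof.
move=> q0 q'0.
by rewrite eqr_div ?tofrac_eq0 // -!tofracM tofrac_eq.
Qed.

Lemma frac_reprE f : f = (\n_(repr f))%:F / (\d_(repr f))%:F.
Proof.
have d0 : \d_(repr f) != 0 by exact: denom_ratioP.
have dF0 : (\d_(repr f))%:F != 0 :> {fraction {poly F}} by rewrite tofrac_eq0.
apply: (mulIf dF0); rewrite mulfVK //.
rewrite -{1}[f]reprK; move: (repr f) d0 {dF0} => r r0.
rewrite !piE; apply/eqmodP.
rewrite /= FracField.equivfE /FracField.mulf !numden_Ratio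
  ?mulf_neq0 ?oner_neq0 //.
by rewrite !mulr1 mulrC.
Qed.

Lemma ratnum_ratdenE f : f = (ratnum f)%:F / (ratden f)%:F.
Proof.
rewrite {1}[f]frac_reprE; apply/eqP.
rewrite frac_divE ?ratden_neq0 ?denom_ratioP // /ratnum /ratden.
by rewrite mulrC divp_mulAC ?dvdp_gcdr // -divp_mulA ?dvdp_gcdl //
  [_ %/ _ * _]mulrC mulrC.
Qed.

Lemma ratderivE p q : q != 0 ->
  ratderiv (p%:F / q%:F) = (p^`() * q - p * q^`())%:F / (q ^+ 2)%:F.
Proof.
move=> q0; set f := _ / _.
have m0 := ratden_neq0 f.
have := ratnum_ratdenE f; rewrite {1}/f => /eqP.
rewrite frac_divE // /ratderiv.
move: (ratnum f) (ratden f) m0 => n m m0 /eqP e.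
apply/eqP; rewrite frac_divE ?expf_neq0 //; apply/eqP.
have e' : p^`() * m = n^`() * q + n * q^`() - p * m^`().
  by rewrite -derivM -e derivM addrK.
symmetry; transitivity (p^`() * m * (q * m) - p * m * (q^`() * m)); first by ring.
rewrite e'; transitivity (n^`() * m * q ^+ 2 + n * q * (q^`() * m)
  - p * m * (m^`() * q) - p * m * (q^`() * m)); first by ring.
by rewrite e; ring.
Qed.

End RationalFunctions.

Section Problem.

Variables (F : fieldType) (n : nat).
Implicit Types c A : 'I_n -> F.

Definition potential c A : {fraction {poly F}} :=
  - (3 / 2) * \sum_i ((A i)%:P * ('X - (c i)%:P) + 1)%:F
                       / (('X - (c i)%:P) ^+ 2)%:F.

Definition L_val c A (i : 'I_n) : F :=
  3 * A i ^+ 2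
    - 4 * \sum_(j | j != i) (A j * (c i - c j) + 1) / (c i - c j) ^+ 2.

(* [E_succ c A m] is E_(m+1).  For m = 0 the exponent m.-1 is 0, but the term is
   killed by the factor m%:R. *)
Definition E_succ c A (m : nat) : F :=
  \sum_i (m%:R * c i ^+ m.-1 + c i ^+ m * A i).

End Problem.

(* Main.v *)
Require Import Defs.
From mathcomp Require Import all_boot all_order all_algebra.
From mathcomp Require Import complex reals.
From mathcomp Require Import ring zify.
Import GRing.Theory.
Local Open Scope ring_scope.

(** Write P for the product of the X - c_i, n = 2d - 2 for its degree, and q for the sum
    of the (A_i (z - c_i) + 1) / (z - c_i)^2, so that the potential is -3/2 q.

    A function f has Schwarzian derivative S iff it is a quotient of two independent
    solutions of y'' + S/2 y = 0.  For S = -3/2 q the local exponents at c_i are -1/2 and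
    3/2, and y = w / sqrt P turns the equation into a Lame equation with polynomial
    coefficients,
      P w'' - P' w' + T w = 0,    4 P T = 3 P'^2 - 2 P P'' - 3 P^2 q,
    whose exponents are 0 and 2 at each c_i and, when E_1 = E_2 = 0, d and d - 1 at
    infinity.  Everything is read off this equation, over any field of characteristic 0.

    - The equation L_i = 0 says that there is no logarithm at c_i
      (lame_obstruction); E_1 = ... = E_m = 0 says that q decreases at
      least like z^(-m-1) (size_potnumP).

    - If f = N/M has degree d, the Schwarzian derivative is a polynomial in N, M and
      their derivatives over the square of the Wronskian W = N'M - NM'
      (schwarzian_wronskian).  The double poles of the potential force W to vanish at each
      c_i; since deg W <= 2d - 2, W is a multiple of P.  This gives the simple
      critical points, the regularity at infinity, and the Lame equation for N and M
      (solution_wronskian, lame_wronskian).  As N and M do not both vanish at c_i,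
      there is no logarithm there; as one of them has degree d, there is none at infinity
      either, and E_1 = E_2 = E_3 = 0.  This is (1) => (2), and (2) contains (3) and (4).

    - Conversely, two polynomial solutions N and M of the Lame equation, of degrees d
      and d - 1, have a multiple of P as Wronskian and yield the rational function N/M
      (solution_of_lame).  They come from counting linear equations
      (exists_poly_operator_eq0): at a node without logarithm, once the image of w under
      the Lame operator vanishes it vanishes doubly.  Under (4), the polynomials w of degree
      at most n+1 have an image of degree at most 2n-1, so that n linear equations on the
      n+2 coefficients of w make the image zero.  One more equation may be imposed, the
      vanishing of the coefficient of degree d, respectively d-1, and the exponents at
      infinity then leave a solution of degree d-1, respectively d
      (solution_of_lame_coef_eq0).

    - Under (3) the excluded node c_k takes over the role of infinity: w is allowed
      a pole of order d-2 at c_k, while E_3 = 0 allows for the bound d on its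
      degree at infinity.  There are n+1 unknowns and n-1 equations, and again one
      more may be imposed.  The exponents at c_k being nonnegative, these solutions are
      polynomials (lame_pole_eq0). *)

Set Implicit Arguments.
Unset Strict Implicit.
Unset Printing Implicit Defensive.

(** * Polynomials and counting of linear conditions *)

Section PolynomialTools.

Variable F : fieldType.
Implicit Types (p q g u : {poly F}) (x : F) (s : seq F) (j m : nat).

Lemma coefM_top p q i j : (size p <= i.+1)%N -> (size q <= j.+1)%N ->
  (p * q)`_(i + j) = p`_i * q`_j.
Proof.
move=> sp sq; rewrite coefM.
have hi : (i < (i + j).+1)%N by rewrite ltnS leq_addr.
rewrite (bigD1 (Ordinal hi)) //= big1 ?addr0 ?addKn // => k nk.
have [lt_ki|le_ik] := ltnP k i.
  by rewrite (leq_sizeP _ _ sq) ?mulr0 //; lia.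
rewrite (leq_sizeP _ _ sp) ?mul0r // ltn_neqAle le_ik andbT.
by apply: contra nk => /eqP e; apply/eqP/val_inj.
Qed.

(** Sizes only bound degrees from above here, so that no case distinction on vanishing
    leading coefficients is needed when this is applied to derivatives. *)
Lemma coefM_subtop p q i j : (size p <= i.+2)%N -> (size q <= j.+2)%N ->
  (p * q)`_(i + j).+1 = p`_i.+1 * q`_j + p`_i * q`_j.+1.
Proof.
move=> sp sq; pose p1 := p - p`_i.+1 *: 'X^(i.+1).
have sp1 : (size p1 <= i.+1)%N.
  apply/leq_sizeP => k lk; rewrite !coefE.
  case: eqVneq => [->|nk]; first by rewrite mulr1 subrr.
  by rewrite mulr0 subr0 (leq_sizeP _ _ sp) //; lia.
have -> : p * q = p1 * q + p`_i.+1 *: ('X^(i.+1) * q).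
  by rewrite /p1 mulrBl scalerAl addrNK.
rewrite coefD coefZ coefXnM ltnS ltnNge leq_addr /= subSS addKn addrC.
rewrite -addnS coefM_top //; congr (_ + _ * _).
by rewrite coefB coefZ coefXn ltn_eqF // mulr0 subr0.
Qed.

Lemma size_polyD_leq k p q : (size p <= k)%N -> (size q <= k)%N ->
  (size (p + q)%R <= k)%N.
Proof.
by move=> sp sq; apply: leq_trans (size_polyD _ _) _; rewrite geq_max sp.
Qed.

Lemma size_polyM_leq k i j p q : (size p <= i)%N -> (size q <= j)%N ->
  (i + j <= k.+1)%N -> (size (p * q)%R <= k)%N.
Proof.
move=> sp sq ijk; apply: leq_trans (size_polyMleq _ _) _.
by rewrite -subn1 leq_subLR add1n (leq_trans (leq_add sp sq)).
Qed.

Lemma size_natmul_leq k p m : (size p <= k)%N -> (size (p *+ m) <= k)%N.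
Proof.
move=> sp; apply/leq_sizeP => j lj.
by rewrite coefMn (leq_sizeP _ _ sp) // mul0rn.
Qed.

Lemma size_mul_leq_deg p q i j : (size p <= i.+1)%N -> (size q <= j.+1)%N ->
  (size (p * q)%R <= (i + j).+1)%N.
Proof. by move=> sp sq; rewrite (size_polyM_leq sp sq) // addSn addnS. Qed.

Lemma size_deriv_leq p i : (size p <= i.+1)%N -> (size p^`() <= i)%N.
Proof.
move=> sp; apply/leq_sizeP => j lj.
by rewrite coef_deriv (leq_sizeP _ _ sp) ?mul0rn.
Qed.

(** Derivatives are multiplied by powers of 'X, so that the top coefficients of p, X p'
    and X^2 p'' have the same index, whatever the degree of p. *)
Lemma coef_Xderiv p i : ('X * p^`())`_i = i%:R * p`_i.
Proof. by rewrite coefXM coef_deriv; case: i => [|i]; rewrite ?mul0r //= mulr_natl. Qed.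

Lemma coef_X2deriv2 p i : ('X^2 * p^`()^`())`_i = i%:R * (i%:R - 1) * p`_i.
Proof.
rewrite coefXnM !coef_deriv; case: i => [|[|i]] /=; rewrite ?mul0r //.
  by rewrite subrr mulr0 mul0r.
have -> : i.+2%:R - 1 = i.+1%:R :> F by rewrite -natr1 addrK.
by rewrite subSS subn1 /= -natrM mulr_natl -mulrnA.
Qed.

Lemma size_Xderiv_leq p i : (size p <= i)%N -> (size ('X * p^`())%R <= i)%N.
Proof.
move=> sp; apply/leq_sizeP => j lj.
by rewrite coef_Xderiv (leq_sizeP _ _ sp) ?mulr0.
Qed.

Lemma size_X2deriv2_leq p i :
  (size p <= i)%N -> (size ('X^2 * p^`()^`())%R <= i)%N.
Proof.
move=> sp; apply/leq_sizeP => j lj.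
by rewrite coef_X2deriv2 (leq_sizeP _ _ sp) ?mulr0.
Qed.

(** After division by the product of the X - x, for x in s, the quotient still vanishes
    on s, and it has at most size s coefficients. *)
Lemma eq0_of_double_roots s g : uniq s ->
  (forall x, x \in s -> root g x && root g^`() x) ->
  (size g <= 2 * size s)%N -> g = 0.
Proof.
move=> us hg sg; apply: contraTeq isT => g0.
have /dvdpP[h gE] : \prod_(x <- s) ('X - x%:P) %| g.
  apply: uniq_roots_dvdp; last by rewrite uniq_rootsE.
  by apply/allP => x /hg/andP[].
have P0 : \prod_(x <- s) ('X - x%:P) != 0 :> {poly F}.
  by rewrite monic_neq0 // monic_prod_XsubC.
have h0 : h != 0 by apply: contraNneq g0 => h0; rewrite gE h0 mul0r.
case/eqP: (h0); apply: (@roots_geq_poly_eq0 _ h s) => //; last first.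
  move: sg; rewrite gE size_Mmonic ?monic_prod_XsubC // ?size_prod_XsubC.
  by rewrite addnS /= mul2n -addnn leq_add2r.
apply/allP => x xs; have /andP[/factor_theorem[g1 g1E] /eqP] := hg x xs.
rewrite g1E derivM derivXsubC mulr1 hornerD hornerM hornerXsubC subrr mulr0 add0r.
move/eqP => r1.
have : (2 <= mup x g)%N.
  by rewrite mup_geq // g1E expr2 dvdp_mul // dvdp_XsubCl.
rewrite gE mupM // mu_prod_XsubC count_uniq_mem // xs addn1 ltnS.
by rewrite -XsubC_dvd // dvdp_XsubCl.
Qed.

Lemma scalar_sum (phi : {poly F} -> F) k (v : 'I_k -> F) (p : 'I_k -> {poly F}) :
  scalar phi -> phi (\sum_i v i *: p i) = \sum_i v i * phi (p i).
Proof.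
move=> lin; have phi0 : phi 0 = 0.
  by have := lin (-1) 0 0; rewrite scaler0 addr0 mulN1r addNr.
by elim/big_rec2: _ => // i y z _ <-; rewrite lin.
Qed.

(** A linear system with more unknowns, the k.+1 coefficients of u, than
    equations. *)
Lemma exists_poly_scalar_eq0 k (phi : 'I_k -> {poly F} -> F) :
  (forall i, scalar (phi i)) ->
  exists u, [/\ u != 0, (size u <= k.+1)%N & forall i, phi i u = 0].
Proof.
move=> lin; pose B := \matrix_(i < k.+1, j < k) phi j ('X^i : {poly F}).
have : kermx B != 0.
  by rewrite kermx_eq0 /row_free neq_ltn (leq_ltn_trans (rank_leq_col B)).
case/rowV0Pn => v /sub_kermxP vB v0; exists (rVpoly v); split.
- by apply: contraNneq v0 => e; rewrite -[v]rVpolyK e linear0.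
- exact: size_poly.
move=> i; have /rowP/(_ i) := vB; rewrite !mxE => e.
rewrite /rVpoly poly_def.
under eq_bigr => j _ do rewrite (valK j).
by rewrite (scalar_sum _ _ (lin i)) -[RHS]e; apply: eq_bigr => j _; rewrite mxE.
Qed.

(** The points of s are singular points of the operator
    u |-> a u'' + b u' + e u  at which, by the last two hypotheses, the vanishing of
    the value of the operator forces the vanishing of its first derivative. So
    size s linear equations on u give 2 * size s zeros, too many for
    the degree of the image.  One more equation is still affordable. *)
Lemma exists_poly_operator_eq0 s (a b e : {poly F}) (phi : {poly F} -> F) :
  let D u := a * u^`()^`() + b * u^`() + e * u in
  uniq s -> scalar phi ->
  (forall x, x \in s -> [/\ a.[x] = 0, a^`().[x] + b.[x] = 0, b.[x] != 0 &
     (b^`().[x] + e.[x]) * e.[x] = e^`().[x] * b.[x]]) ->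
  (forall u, (size u <= (size s).+2)%N -> (size (D u) <= 2 * size s)%N) ->
  exists u, [/\ u != 0, (size u <= (size s).+2)%N, D u = 0 & phi u = 0].
Proof.
move=> D us lin hs hD.
pose psi (i : 'I_(size s).+1) u :=
  if unlift ord0 i is Some j then (D u).[tnth (in_tuple s) j] else phi u.
have linpsi i : scalar (psi i).
  rewrite /psi; case: unlift => [j|//] t p q.
  set x := tnth _ _; change ((D (t *: p + q)%R).[x] = t * (D p).[x] + (D q).[x]).
  by rewrite /D !derivE !(hornerD, hornerM, hornerZ); ring.
have [u [u0 su psiu]] := exists_poly_scalar_eq0 linpsi.
exists u; split=> //; last by have := psiu ord0; rewrite /psi unlift_none.
apply: (eq0_of_double_roots us) => [x xs|]; last exact: hD.
have Dx : (D u).[x] = 0.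
  have jx : (index x s < size s)%N by rewrite index_mem.
  have := psiu (lift ord0 (Ordinal jx)); rewrite /psi liftK.
  by rewrite (tnth_nth 0) /= nth_index.
rewrite {1}/root Dx eqxx /=; apply/rootP.
have [ax abx bx ebx] := hs x xs.
have u1E : b.[x] * u^`().[x] = - (e.[x] * u.[x]).
  by move: Dx; rewrite /D !hornerE ax; move/eqP; rewrite mul0r add0r addr_eq0 => /eqP.
apply: (mulfI bx); rewrite mulr0 /D !derivE !(hornerD, hornerM) ax.
have -> : a^`().[x] = - b.[x] by apply/eqP; rewrite -addr_eq0 abx.
transitivity ((b^`().[x] + e.[x]) * (b.[x] * u^`().[x])
              + (e^`().[x] * b.[x]) * u.[x]); first by ring.
by rewrite u1E -ebx; ring.
Qed.

End PolynomialTools.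

(** * Leading terms at infinity *)

Section LeadingTerms.

Variables (F : fieldType) (n d : nat).
Hypotheses (charF0 : [pchar F] =i pred0) (nE : n = (2 * d - 2)%N) (dgt1 : (1 < d)%N).
Variable P : {poly F}.
Hypotheses (Pmonic : P \is monic) (sizeP : size P = n.+1).
Implicit Type w : {poly F}.

Lemma natr_eq0_char0 k : (k%:R == 0 :> F) = (k == 0%N).
Proof. by move/pcharf0P: charF0. Qed.

(** This is 4 P^(5/2) (w / sqrt P)''. *)
Definition gauge w : {poly F} :=
  (P * P * w^`()^`()) *+ 4 - (P * P^`() * w^`()) *+ 4
  + ((P^`() * P^`()) *+ 3 - (P * P^`()^`()) *+ 2) * w.

Lemma X2_gauge w : 'X^2 * gauge w =
  (P * P * ('X^2 * w^`()^`())) *+ 4 - (P * ('X * P^`()) * ('X * w^`())) *+ 4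
  + ((('X * P^`()) * ('X * P^`())) *+ 3 - (P * ('X^2 * P^`()^`())) *+ 2) * w.
Proof. by rewrite /gauge; ring. Qed.

Lemma natr_n : n%:R = 2 * d%:R - 2 :> F.
Proof. by rewrite nE natrB ?natrM //; lia. Qed.

Lemma sizeP_leq : (size P <= n.+1)%N. Proof. by rewrite sizeP. Qed.

Lemma leadP : P`_n = 1.
Proof. by move: Pmonic; rewrite monicE lead_coefE sizeP /= => /eqP. Qed.

Let sizes := (sizeP_leq, size_Xderiv_leq sizeP_leq, size_X2deriv2_leq sizeP_leq).

Lemma size_X2_gauge w s : (size w <= s.+1)%N ->
  (size ('X^2 * gauge w)%R <= (n + n + s).+1)%N.
Proof.
move=> sw; have sw1 := size_Xderiv_leq sw; have sw2 := size_X2deriv2_leq sw.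
have sM := @size_mul_leq_deg F.
apply/leq_sizeP => j lj; have z (p : {poly F}) : (size p <= (n + n + s).+1)%N -> p`_j = 0.
  by move=> sp; rewrite (leq_sizeP _ _ sp).
rewrite X2_gauge mulrBl !mulrnAl !(coefD, coefN, coefMn).
by rewrite !z ?sM ?sizes // !(mul0rn, subr0, addr0).
Qed.

(** The roots d and d - 1 of this quadratic polynomial in s are the exponents
    at infinity of the operator. *)
Lemma coef_X2_gauge_top w s : (size w <= s.+1)%N ->
  ('X^2 * gauge w)`_(n + n + s) = 4 * (s%:R - d%:R) * (s%:R - d%:R + 1) * w`_s.
Proof.
move=> sw; have sw1 := size_Xderiv_leq sw; have sw2 := size_X2deriv2_leq sw.
have sM := @size_mul_leq_deg F.
rewrite X2_gauge mulrBl !mulrnAl !(coefD, coefN, coefMn).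
rewrite !coefM_top ?sM ?sizes // !(coef_X2deriv2, coef_Xderiv) leadP natr_n.
by ring.
Qed.

(** The exponents d and d - 1 differ by one, so the next coefficient might have
    obstructed a solution of degree d; it cancels too, whatever the second
    coefficient of P is. *)
Lemma size_gauge w : (size w <= d.+1)%N -> (size (gauge w) <= n + n + d - 3)%N.
Proof.
move=> sw; have sw1 := size_Xderiv_leq sw; have sw2 := size_X2deriv2_leq sw.
have sM := @size_mul_leq_deg F.
apply/leq_sizeP => j lj.
have -> : (gauge w)`_j = ('X^2 * gauge w)`_(j + 2).
  by rewrite coefXnM addnK ltnNge leq_addl.
have [lt_j|] := ltnP (n + n + d) (j + 2).
  by rewrite (leq_sizeP _ _ (size_X2_gauge sw)).
rewrite leq_eqVlt => /predU1P[->|lt_j].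
  by rewrite coef_X2_gauge_top // subrr mulr0 !mul0r.
have [m nm] : exists m, n = m.+1 by exists n.-1; lia.
have [e de] : exists e, d = e.+1 by exists d.-1; lia.
have Pm : P`_m.+1 = 1 by rewrite -nm leadP.
have sP : (size P <= m.+2)%N by rewrite sizeP nm.
have sP1 := size_Xderiv_leq sP; have sP2 := size_X2deriv2_leq sP.
rewrite de in sw sw1 sw2.
have -> : (j + 2 = (m.+1 + m + e).+1)%N by lia.
have m2 : (m + m).+2 = (m.+1 + m.+1)%N by rewrite addSn addnS.
have mm : (m.+1 + m)%N = (m + m).+1 by [].
rewrite X2_gauge mulrBl !mulrnAl !(coefD, coefN, coefMn) mm.
have sMM (p q : {poly F}) : (size p <= m.+2)%N -> (size q <= m.+2)%N ->
    (size (p * q)%R <= (m + m).+3)%N.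
  by move=> sp sq; rewrite -addSn -addnS sM.
rewrite !(@coefM_subtop _ _ _ (m + m).+1 e) ?sMM //.
rewrite !(@coefM_subtop _ _ _ m m) // m2 !coefM_top //.
rewrite !(coef_X2deriv2, coef_Xderiv) Pm.
have -> : e.+1%:R = e%:R + 1 :> F by rewrite natr1.
have -> : m.+1%:R = 2 * e%:R :> F.
  by rewrite -nm natr_n de -natr1; ring.
have -> : m%:R = 2 * e%:R - 1 :> F.
  by apply: (addIr 1); rewrite natr1 -nm natr_n de -natr1; ring.
by ring.
Qed.

End LeadingTerms.

(** * The potential and its Lame equation *)

Section Potential.

Variables (F : fieldType) (n : nat).
Hypothesis charF0 : [pchar F] =i pred0.
Variables (c A : 'I_n -> F).
Hypothesis c_inj : injective c.

Definition nodepoly : {poly F} := \prod_i ('X - (c i)%:P).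
Definition conodepoly i : {poly F} := \prod_(j | j != i) ('X - (c j)%:P).

(** Over nodepoly ^+ 2, this is the proper part of X^m q, where q is the sum of the
    (A_i (X - c_i) + 1) / (X - c_i)^2; in particular it is q itself for m = 0.  The
    coefficient of 1/X in the proper part of X^m q is E_(m+1), whence momentnumS. *)
Definition momentnum m : {poly F} :=
  \sum_i (((m%:R * c i ^+ m.-1 + c i ^+ m * A i)%:P * ('X - (c i)%:P)
           + (c i ^+ m)%:P) * conodepoly i ^+ 2).

Local Notation P := nodepoly.
Local Notation G := (momentnum 0).

Lemma nodepolyE i : P = ('X - (c i)%:P) * conodepoly i.
Proof. by rewrite /nodepoly (bigD1 i). Qed.

Lemma nodepoly_monic : P \is monic.
Proof. exact: monic_prod_XsubC. Qed.

Lemma size_nodepoly : size P = n.+1.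
Proof.
by rewrite /nodepoly size_prod_XsubC /index_enum -enumT size_enum_ord.
Qed.

Lemma nodepoly_root i : P.[c i] = 0.
Proof. by rewrite (nodepolyE i) hornerM hornerXsubC subrr mul0r. Qed.

Lemma conodepoly_neq0 i : (conodepoly i).[c i] != 0.
Proof.
rewrite horner_prod; apply/prodf_neq0 => j ji.
by rewrite hornerXsubC subr_eq0; apply: contra ji => /eqP/c_inj ->.
Qed.

Lemma deriv_nodepoly i : P^`().[c i] = (conodepoly i).[c i].
Proof.
by rewrite (nodepolyE i) derivM derivXsubC hornerD !hornerM hornerXsubC hornerC
  subrr mul1r mul0r addr0.
Qed.

Lemma deriv_nodepoly_neq0 i : P^`().[c i] != 0.
Proof. by rewrite deriv_nodepoly conodepoly_neq0. Qed.

Lemma size_conodepoly i : size (conodepoly i) = n.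
Proof.
have := size_nodepoly; rewrite (nodepolyE i) size_monicM ?monicXsubC //.
  by rewrite size_XsubC => -[].
by apply: contraNneq (conodepoly_neq0 i) => ->; rewrite horner0.
Qed.

Lemma nodepoly_dvdp p : (forall i, p.[c i] = 0) -> P %| p.
Proof.
move=> hp; rewrite /nodepoly -(big_map c xpredT (fun x => 'X - x%:P)).
apply: uniq_roots_dvdp.
  by apply/allP => x /mapP[i _ ->]; apply/rootP.
by rewrite uniq_rootsE map_inj_uniq // index_enum_uniq.
Qed.

Lemma potnumE : G = \sum_i ((A i)%:P * ('X - (c i)%:P) + 1) * conodepoly i ^+ 2.
Proof.
apply: eq_bigr => i _.
by rewrite mul0r add0r mul1r expr0 polyC1.
Qed.

Lemma potentialE : potential c A = (- (G *+ 3))%:F / (P ^+ 2 *+ 2)%:F.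
Proof.
have P0 : P != 0 by rewrite monic_neq0 ?nodepoly_monic.
rewrite /potential; set S := \sum_i _.
have -> : S = G%:F / (P ^+ 2)%:F.
  rewrite potnumE rmorph_sum /= mulr_suml; apply: eq_bigr => i _.
  have q0 : conodepoly i != 0.
    by apply: contraNneq (conodepoly_neq0 i) => ->; rewrite horner0.
  apply/eqP; rewrite frac_divE ?expf_neq0 ?polyXsubC_eq0 //; apply/eqP.
  by rewrite (nodepolyE i); ring.
have two0 : 2 != 0 :> {poly F} by rewrite -polyC_natr polyC_eq0 natr_eq0_char0.
have -> : - (3 / 2) = (- 3)%:F / 2%:F :> {fraction {poly F}}.
  by rewrite rmorphN mulNr !rmorph_nat.
rewrite mulf_div -!tofracM; apply/eqP.
have P2 : P ^+ 2 *+ 2 != 0 by rewrite -mulr_natl mulf_neq0 ?expf_neq0.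
rewrite frac_divE ?mulf_neq0 ?expf_neq0 //.
by apply/eqP; ring.
Qed.

Lemma momentnumS m :
  'X * momentnum m = (E_succ c A m)%:P * P ^+ 2 + momentnum m.+1.
Proof.
rewrite /E_succ rmorph_sum /= mulr_suml mulr_sumr -big_split /=.
apply: eq_bigr => i _; rewrite (nodepolyE i).
set q := conodepoly i.
have -> : m.+1%:R * c i ^+ m + c i ^+ m.+1 * A i
    = c i * (m%:R * c i ^+ m.-1 + c i ^+ m * A i) + c i ^+ m.
  rewrite -natr1 exprS; case: m => [|m] /=; first by rewrite !expr0; ring.
  by rewrite exprS; ring.
by rewrite [c i ^+ m.+1]exprS !rmorphD !rmorphM /=; ring.
Qed.

Lemma size_momentnum m : (size (momentnum m) <= 2 * n)%N.
Proof.
apply: (leq_trans (size_sum _ _ _)); apply/bigmax_leqP => i _.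
have n0 : (0 < n)%N by rewrite (leq_ltn_trans _ (ltn_ord i)).
have [k nk] : exists k, n = k.+1 by exists n.-1; rewrite prednK.
have -> : (2 * n = (1 + (k + k)).+1)%N by lia.
rewrite size_mul_leq_deg ?expr2 ?size_mul_leq_deg ?size_conodepoly ?nk //.
apply/leq_sizeP => -[|[|j]] // _.
by rewrite coefD coefCM coefB coefX !coefC /= !subr0 mulr0 addr0.
Qed.

(** The E_(k+1) are the coefficients of the expansion of the potential at infinity, and
    the denominator P^2 has degree 2n. *)
Lemma size_potnumP m : (m <= 2 * n)%N ->
  reflect (forall k, (k < m)%N -> E_succ c A k = 0) (size G <= 2 * n - m)%N.
Proof.
move=> m2n.
have XG k : (forall j, (j < k)%N -> E_succ c A j = 0) -> 'X^k * G = momentnum k.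
  elim: k => [|k IHk] hk; first by rewrite mul1r.
  rewrite exprS -mulrA IHk => [|j jk]; last by rewrite hk // ltnW.
  by rewrite momentnumS hk // mul0r add0r.
apply: (iffP idP) => [sG|hm].
  move=> k; elim/ltn_ind: k => k IHk km.
  have e : 'X^(k.+1) * G = (E_succ c A k)%:P * P ^+ 2 + momentnum k.+1.
    by rewrite exprS -mulrA XG ?momentnumS // => j jk; apply: IHk => //; lia.
  have /(congr1 (fun p : {poly F} => p`_(2 * n))) := e.
  rewrite coefD coefCM (leq_sizeP _ _ (size_momentnum _)) // addr0.
  have -> : (P ^+ 2)`_(2 * n) = 1.
    rewrite mul2n -addnn coefM_top ?size_nodepoly //.
    by rewrite leadP ?nodepoly_monic ?size_nodepoly // mulr1.
  rewrite mulr1 => <-; rewrite coefXnM ltnNge (leq_trans km) //=.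
  by rewrite (leq_sizeP _ _ sG) //; lia.
apply/leq_sizeP => j lj.
have -> : G`_j = ('X^m * G)`_(j + m) by rewrite coefXnM addnK ltnNge leq_addl.
by rewrite XG // (leq_sizeP _ _ (size_momentnum _)) //; lia.
Qed.

Lemma potnum_node i : G.[c i] = P^`().[c i] ^+ 2.
Proof.
rewrite potnumE horner_sum (bigD1 i) //= big1 ?addr0 => [|j ji].
  rewrite !(hornerD, hornerN, hornerM, hornerX, hornerC, horner_exp).
  by rewrite subrr mulr0 add0r mul1r deriv_nodepoly.
rewrite hornerM horner_exp /= [X in _ * X ^+ 2]horner_prod.
by rewrite (bigD1 i) 1?eq_sym //= hornerXsubC subrr mul0r expr0n mulr0.
Qed.

(** The substitution y = w / sqrt P turns the equation y'' + S/2 y = 0, where S is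
    the potential, into P w'' - P' w' + T w = 0. *)
Definition potential_coef (T : {poly F}) : Prop :=
  (P * T) *+ 4 = (P^`() * P^`()) *+ 3 - (P * P^`()^`()) *+ 2 - G *+ 3.

Definition lame (T w : {poly F}) : {poly F} :=
  P * w^`()^`() - P^`() * w^`() + T * w.

(** At a node both P' ^2 and the numerator of the potential take the value P'(c_i)^2,
    because the coefficient of 1/(z - c_i)^2 is 1. *)
Lemma exists_potential_coef : exists T, potential_coef T.
Proof.
have /dvdpP[h hE] : P %| P^`() * P^`() - G.
  apply: nodepoly_dvdp => i.
  by rewrite hornerD hornerN hornerM potnum_node expr2 subrr.
have n4 : 4 != 0 :> F by rewrite natr_eq0_char0.
exists (4^-1 *: (h *+ 3 - P^`()^`() *+ 2)).
rewrite /potential_coef -scalerAr -scaler_nat scalerA mulfV // scale1r.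
have -> : G = P^`() * P^`() - h * P by rewrite -hE; ring.
by ring.
Qed.

Lemma lame_gauge T w : potential_coef T ->
  (P * lame T w) *+ 4 = gauge P w - (G * w) *+ 3.
Proof.
move=> hT; transitivity ((P * P * w^`()^`()) *+ 4 - (P * P^`() * w^`()) *+ 4
  + (P * T) *+ 4 * w); first by rewrite /lame; ring.
by rewrite hT /gauge; ring.
Qed.

(** The left-hand side obstructs a local solution that does not vanish at the node
    and has no logarithm there.  With a = P, b = - P' and e = T, its vanishing
    is also the last condition in exists_poly_operator_eq0. *)
Lemma lame_obstruction T i : potential_coef T ->
  16 * (T.[c i] ^+ 2 - P^`()^`().[c i] * T.[c i] + P^`().[c i] * T^`().[c i])
  = 3 * P^`().[c i] ^+ 2 * L_val c A i.
Proof.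
rewrite /potential_coef => hT; set x := c i; set q := conodepoly i.
(* With t = X - c_i, the numerator is (A_i t + 1) q^2 + t^2 K, where q and K collect
   the other nodes.  The equation of T can then be divided by t once, so that one
   derivative is enough to reach T' at the node. *)
pose r j : {poly F} := \prod_(k | (k != i) && (k != j)) ('X - (c k)%:P).
have qr j : j != i -> q = ('X - (c j)%:P) * r j.
  by move=> ji; rewrite /q /conodepoly (bigD1 j).
have cr j : j != i -> conodepoly j = ('X - x%:P) * r j.
  move=> ji; rewrite /conodepoly (bigD1 i) 1?eq_sym //=; congr (_ * _).
  by apply: eq_bigl => k; rewrite andbC.
pose K := \sum_(j | j != i) ((A j)%:P * ('X - (c j)%:P) + 1) * r j ^+ 2.
pose t := 'X - x%:P.
have GE : G = ((A i)%:P * t + 1) * (q * q) + t * t * K.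
  rewrite potnumE (bigD1 i) //= expr2; congr (_ + _).
  rewrite mulr_sumr; apply: eq_bigr => j ji; rewrite cr // -/t; ring.
have q0 : q.[x] != 0 by apply: conodepoly_neq0.
have Kx : K.[x] =
    q.[x] ^+ 2 * \sum_(j | j != i) (A j * (c i - c j) + 1) / (c i - c j) ^+ 2.
  rewrite horner_sum mulr_sumr; apply: eq_bigr => j ji.
  rewrite (qr j) // !(hornerD, hornerN, hornerM, hornerX, hornerC, horner_exp) -/x.
  have : x - c j != 0 by rewrite subr_eq0; apply: contra ji => /eqP/c_inj ->.
  by move=> ?; field.
have tx : t.[x] = 0 by rewrite hornerXsubC subrr.
have t1 : t^`() = 1 by rewrite derivXsubC.
have PE : P = t * q by apply: nodepolyE.
have P1 : P^`() = q + t * q^`() by rewrite PE derivM t1 mul1r.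
have P2 : P^`()^`() = q^`() *+ 2 + t * q^`()^`().
  by rewrite P1 derivD derivM t1; ring.
have t0 : t != 0 by rewrite polyXsubC_eq0.
clearbody t K q x.
have hT' : (q * T) *+ 4 = (q * q^`()) *+ 2 - (A i)%:P * (q * q) *+ 3
    + t * ((q^`() * q^`()) *+ 3 - (q * q^`()^`()) *+ 2 - K *+ 3).
  apply: (mulfI t0); transitivity ((P * T) *+ 4); first by rewrite PE; ring.
  by rewrite hT P2 P1 GE PE; ring.
have e1 : 4 * T.[x] = 2 * q^`().[x] - 3 * A i * q.[x].
  apply: (mulfI q0); have := congr1 (fun p : {poly F} => p.[x]) hT'.
  rewrite !(hornerMn, hornerD, hornerN, hornerM, hornerC) tx => e.
  by transitivity ((q.[x] * T.[x]) *+ 4); [ring | rewrite e; ring].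
have e2 : 4 * q.[x] * T^`().[x] = 5 * q^`().[x] ^+ 2 - 6 * A i * q.[x] * q^`().[x]
    - 3 * K.[x] - 4 * T.[x] * q^`().[x].
  have := congr1 (fun p : {poly F} => p^`().[x]) hT'.
  rewrite !(derivMn, derivD, derivN, derivM, derivC) t1.
  rewrite !(hornerMn, hornerD, hornerN, hornerM, hornerC) tx => e.
  apply: (addIr (4 * T.[x] * q^`().[x])); rewrite subrK.
  by transitivity ((q^`().[x] * T.[x] + q.[x] * T^`().[x]) *+ 4);
    [ring | rewrite e; ring].
rewrite P2 P1 !(hornerMn, hornerD, hornerM) tx /L_val -/x.
transitivity ((4 * T.[x]) ^+ 2 - 8 * q^`().[x] * (4 * T.[x])
  + 4 * (4 * q.[x] * T^`().[x])); first by ring.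
rewrite e2 e1 Kx; ring.
Qed.


End Potential.

(** * Wronskians and Schwarzian derivatives of rational functions *)

Section Wronskian.

Variable F : fieldType.
Implicit Types (N M : {poly F}) (a : F).

Definition wronskian N M : {poly F} := N^`() * M - N * M^`().

Lemma wronskianC N M : wronskian M N = - wronskian N M.
Proof. by rewrite /wronskian; ring. Qed.

Lemma X_wronskian N M :
  'X * wronskian N M = ('X * N^`()) * M - N * ('X * M^`()).
Proof. by rewrite /wronskian; ring. Qed.

(** The coefficients at the top degree cancel. *)
Lemma size_wronskian N M e : (size N <= e.+2)%N -> (size M <= e.+2)%N ->
  (size (wronskian N M) <= (e + e).+1)%N.
Proof.
move=> sN sM; have sN1 := size_Xderiv_leq sN; have sM1 := size_Xderiv_leq sM.
apply/leq_sizeP => j lj.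
have -> : (wronskian N M)`_j = ('X * wronskian N M)`_j.+1 by rewrite coefXM.
rewrite X_wronskian coefB.
have [lt_j|] := ltnP (e.+1 + e.+1) j.+1.
  have z (p : {poly F}) : (size p <= (e.+1 + e.+1).+1)%N -> p`_j.+1 = 0.
    by move=> sp; rewrite (leq_sizeP _ _ sp).
  by rewrite !z ?size_mul_leq_deg // subrr.
rewrite leq_eqVlt => /predU1P[->|]; last by lia.
by rewrite !coefM_top // !coef_Xderiv; ring.
Qed.

Lemma coef_wronskian N M e : (size N <= e.+2)%N -> (size M <= e.+2)%N ->
  (wronskian N M)`_(e + e) = N`_e.+1 * M`_e - N`_e * M`_e.+1.
Proof.
move=> sN sM; have sN1 := size_Xderiv_leq sN; have sM1 := size_Xderiv_leq sM.
have -> : (wronskian N M)`_(e + e) = ('X * wronskian N M)`_(e + e).+1 by rewrite coefXM.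
rewrite X_wronskian coefB !coefM_subtop // !coef_Xderiv -natr1; ring.
Qed.

Lemma ratnum_cross N M : M != 0 ->
  N * ratden (N%:F / M%:F) = ratnum (N%:F / M%:F) * M.
Proof.
move=> M0; have /eqP := ratnum_ratdenE (N%:F / M%:F).
by rewrite frac_divE ?ratden_neq0 // => /eqP.
Qed.

Lemma ratdeg_coprime N M : M != 0 -> coprimep N M ->
  ratdeg (N%:F / M%:F) = maxn (size N).-1 (size M).-1.
Proof.
move=> M0 cNM; have := ratnum_cross N M0; rewrite /ratdeg.
have := coprime_ratnum_ratden (N%:F / M%:F).
move: (ratnum _) (ratden _) => N1 M1 c1 e.
have eN : N %= N1.
  apply/andP; split.
    by rewrite -(Gauss_dvdpl _ cNM) -e dvdp_mulr.
  by rewrite -(Gauss_dvdpl _ c1) e dvdp_mulr.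
have eM : M %= M1.
  apply/andP; split.
    by rewrite coprimep_sym in cNM; rewrite -(Gauss_dvdpr _ cNM) e dvdp_mull.
  by rewrite coprimep_sym in c1; rewrite -(Gauss_dvdpr _ c1) -e dvdp_mull.
by rewrite (eqp_size eN) (eqp_size eM).
Qed.

Lemma root_ratden N M a : M != 0 -> ~~ (root N a && root M a) ->
  root (ratden (N%:F / M%:F)) a = root M a.
Proof.
move=> M0 nr; have /(congr1 (root^~ a)) := ratnum_cross N M0; rewrite !rootM.
have := coprime_ratnum_ratden (N%:F / M%:F).
move: (ratnum _) (ratden _) => N1 M1 c1.
have : ~~ (root N1 a && root M1 a).
  by apply/nandP; case: (boolP (root N1 a)) => [/(coprimep_root c1)|]; [right | left].
by case: (root N a) (root M a) (root N1 a) (root M1 a) nr => [] [] [] [].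
Qed.

Lemma mup_ratnum N M a : ~~ root M a -> mup a (ratnum (N%:F / M%:F)) = mup a N.
Proof.
move=> rM; have M0 : M != 0 by apply: contraNneq rM => ->; rewrite root0.
have rD : ~~ root (ratden (N%:F / M%:F)) a.
  by rewrite root_ratden // negb_and rM orbT.
by rewrite -(mupMl _ rM) -ratnum_cross // mupMl.
Qed.

(** A common factor of the numerator and the denominator would show up in their
    Wronskian, so they should not vanish together at a. *)
Lemma crit_mult_wronskian N M a : M != 0 -> ~~ (root N a && root M a) ->
  crit_mult (N%:F / M%:F) a = mup a (wronskian N M).
Proof.
move=> M0 nr; rewrite /crit_mult root_ratden //.
have r2 (p : {poly F}) : ~~ root p a -> ~~ root (p ^+ 2) a.
  by rewrite /root horner_exp expf_eq0.
case: ifPn => [rM|rM]; last by rewrite ratderivE // mup_ratnum ?r2.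
have rN : ~~ root N a by move: nr; rewrite rM andbT.
have N0 : N != 0 by apply: contraNneq rN => ->; rewrite root0.
rewrite invf_div ratderivE // mup_ratnum ?r2 //.
have -> : M^`() * N - M * N^`() = (-1)%:P * wronskian N M.
  by rewrite polyCN polyC1 mulN1r -wronskianC.
by rewrite mupMr // /root hornerC oppr_eq0 oner_eq0.
Qed.

(** The Schwarzian derivative has no pole at the poles of f: only the Wronskian is
    left in the denominator. *)
Lemma schwarzian_wronskian N M : 2 != 0 :> F -> M != 0 -> wronskian N M != 0 ->
  let W := wronskian N M in
  let U := N^`()^`() * M^`() - N^`() * M^`()^`() in
  schwarzian (N%:F / M%:F) =
    ((W * W^`()^`()) *+ 2 - (W^`() * W^`()) *+ 3 + (U * W) *+ 4)%:F
    / (W ^+ 2 *+ 2)%:F.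
Proof.
move=> two0F M0 W0 W U; rewrite /schwarzian.
have two0 : 2 != 0 :> {poly F} by rewrite -polyC_natr polyC_eq0.
have UM : U * M = W^`() * M^`() - W * M^`()^`().
  by rewrite /U /W /wronskian !(derivB, derivM); ring.
have -> : ratderiv (N%:F / M%:F) = W%:F / (M ^+ 2)%:F by rewrite ratderivE.
clearbody U; rewrite -/W in W0; clearbody W.
pose B := W^`() * M - (W * M^`()) *+ 2.
have -> : ratderiv (W%:F / (M ^+ 2)%:F) = B%:F / (M ^+ 3)%:F.
  rewrite ratderivE ?expf_neq0 //; apply/eqP.
  by rewrite frac_divE ?expf_neq0 // expr2 derivM; apply/eqP; rewrite /B; ring.
pose C := B^`() * M - (B * M^`()) *+ 3.
have -> : ratderiv (B%:F / (M ^+ 3)%:F) = C%:F / (M ^+ 4)%:F.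
  rewrite ratderivE ?expf_neq0 //; apply/eqP.
  rewrite frac_divE ?expf_neq0 // exprS expr2 !derivM; apply/eqP; rewrite /C; ring.
have -> : 3 / 2 = 3%:F / 2%:F :> {fraction {poly F}} by rewrite !rmorph_nat.
rewrite !invf_div !mulf_div -!tofracM expr_div_n -!tofracXn !mulf_div -!tofracM.
rewrite -mulNr -tofracN addf_div ?tofrac_eq0 ?mulf_neq0 ?expf_neq0 ?mulf_neq0 ?expf_neq0 //.
rewrite -!tofracM -tofracD; apply/eqP.
have W2 : W ^+ 2 *+ 2 != 0 by rewrite -mulr_natl mulf_neq0 ?expf_neq0.
rewrite frac_divE ?mulf_neq0 ?expf_neq0 ?mulf_neq0 ?expf_neq0 //; apply/eqP.
have key : (C * W) *+ 2 - (B * B) *+ 3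
    = (M * M) * ((W * W^`()^`()) *+ 2 - (W^`() * W^`()) *+ 3)
      + (W * M * (W^`() * M^`() - W * M^`()^`())) *+ 4.
  by rewrite /C /B !(derivB, derivMn, derivM); ring.
transitivity (((C * W) *+ 2 - (B * B) *+ 3) * (M ^+ 8 * W ^+ 3 *+ 2)); first by ring.
by rewrite key -UM; ring.
Qed.

End Wronskian.

Section NonzeroWronskian.

Variable F : fieldType.
Hypothesis charF0 : [pchar F] =i pred0.

Lemma deriv_eq0_size (p : {poly F}) : p^`() = 0 -> (size p <= 1)%N.
Proof.
move=> p0; apply/leq_sizeP => -[//|j] _; have /polyP/(_ j)/eqP := p0.
by rewrite coef_deriv coef0 -mulr_natr mulf_eq0 natr_eq0_char0 // orbF => /eqP.
Qed.

(** If N'M = NM' then each of N and M divides its derivative, by coprimality. *)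
Lemma wronskian_neq0 (N M : {poly F}) : coprimep N M -> (1 < maxn (size N).-1 (size M).-1)%N ->
  wronskian N M != 0.
Proof.
move=> cNM; apply: contraTneq => /eqP; rewrite subr_eq0 => /eqP e.
have sz (p q : {poly F}) : coprimep p q -> p^`() * q = p * q^`() -> (size q <= 1)%N.
  move=> cpq epq; apply: deriv_eq0_size; apply: contraTeq isT => q0.
  have : q %| q^`() by rewrite -(Gauss_dvdpr _ (_ : coprimep q p)) 1?coprimep_sym // -epq dvdp_mull.
  move/(dvdp_leq q0); rewrite leqNgt lt_size_deriv //.
  by apply: contraNneq q0 => ->; rewrite deriv0.
have sM := sz _ _ cNM e; have sN : (size N <= 1)%N.
  by apply: (sz M); [rewrite coprimep_sym | rewrite mulrC -e mulrC].
by lia.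
Qed.

End NonzeroWronskian.

(** * The point at infinity, and rational functions with given potential *)

Section Infinity.

Variable F : fieldType.
Implicit Types (p : {poly F}) (f : {fraction {poly F}}).

Lemma exprV_sub (K : fieldType) (x : K) D i : x != 0 -> (i <= D)%N ->
  x^-1 ^+ (D - i) = x ^+ i / x ^+ D.
Proof.
move=> x0 le_iD; rewrite exprVn -{2}(subnK le_iD) exprD invfM mulrCA.
by rewrite mulfV ?mulr1 // expf_neq0.
Qed.

Lemma div_div_cancel (K : fieldType) (x y z : K) : z != 0 ->
  (x / z) / (y / z) = x / y.
Proof. by move=> z0; rewrite invf_div mulrA divfK. Qed.

(** X ^ D * p (1/X), a polynomial when p has degree at most D. *)
Definition recip D p : {poly F} := \poly_(i < D.+1) p`_(D - i).

Lemma horner_invX D p : (size p <= D.+1)%N ->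
  (map_poly (fun x : F => x%:P%:F) p).['X%:F^-1] = (recip D p)%:F / ('X^D)%:F.
Proof.
move=> sp; rewrite (horner_coef_wide _ (leq_trans (size_poly _ _) sp)).
have -> : recip D p = \sum_(i < D.+1) p`_(D - i) *: 'X^i by exact: poly_def.
rewrite (big_morph _ (@tofracD _) (tofrac0 _)) mulr_suml.
rewrite (reindex_inj rev_ord_inj) /=; apply: eq_bigr => i _.
have X0 : 'X%:F != 0 :> {fraction {poly F}} by rewrite tofrac_eq0 polyX_eq0.
have le_iD : (i <= D)%N by rewrite -ltnS.
rewrite coef_poly subSS.
case: ltnP => [lt_i|le_i]; last first.
  by rewrite (leq_sizeP _ _ le_i) // scale0r tofrac0 !mul0r.
rewrite -mul_polyC tofracM -mulrA; congr (_ * _).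
by rewrite !tofracXn exprV_sub.
Qed.

(** The coefficient of degree 2e of the Wronskian is, up to sign, the value at 0 of the
    Wronskian of the two reciprocal polynomials. *)
Lemma regular_at_infinity_wronskian f e :
  (size (ratnum f) <= e.+2)%N -> (size (ratden f) <= e.+2)%N ->
  (wronskian (ratnum f) (ratden f))`_(e + e) != 0 -> regular_at_infinity f.
Proof.
move=> sN sM; rewrite coef_wronskian //; rewrite /regular_at_infinity /ratcomp.
rewrite (horner_invX sN) (horner_invX sM).
set N := ratnum f; set M := ratden f => W0.
have XD0 : ('X^(e.+1))%:F != 0 :> {fraction {poly F}}.
  by rewrite tofrac_eq0 expf_neq0 ?polyX_eq0.
rewrite div_div_cancel //.
have r0 p : (recip e.+1 p).[0] = p`_e.+1 by rewrite horner_coef0 coef_poly subn0.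
have r1 p : (recip e.+1 p)^`().[0] = p`_e.
  by rewrite horner_coef0 coef_deriv coef_poly /= subSS subn0.
have M0 : recip e.+1 M != 0.
  by apply: contraNneq W0 => M0; rewrite -!r0 -!r1 M0 deriv0 !horner0 !mulr0 subrr.
rewrite crit_mult_wronskian //; last first.
  by apply: contra W0 => /andP[/rootP + /rootP]; rewrite !r0 => -> ->; rewrite mulr0 mul0r subrr.
apply: mupNroot; rewrite /root /wronskian hornerD hornerN !hornerM !r0 !r1.
by rewrite -opprB oppr_eq0.
Qed.

End Infinity.

Section Solutions.

Variables (F : fieldType) (n d : nat).
Hypotheses (charF0 : [pchar F] =i pred0) (nE : n = (2 * d - 2)%N) (dgt1 : (1 < d)%N).
Variables (c A : 'I_n -> F).
Hypothesis c_inj : injective c.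
Implicit Types (w N M T : {poly F}) (f : {fraction {poly F}}).

Local Notation P := (nodepoly c).
Local Notation G := (momentnum c A 0).
Local Notation W := wronskian.

Let Pmonic : P \is monic := nodepoly_monic c.
Let sizeP : size P = n.+1 := size_nodepoly c.

Lemma nodepoly_neq0 : P != 0. Proof. exact: monic_neq0. Qed.

Lemma potnum_neq0 : G != 0.
Proof.
have i : 'I_n by apply: (@Ordinal n 0); lia.
have := potnum_node c A i; apply: contra_eq_neq => ->.
by rewrite horner0 eq_sym expf_eq0 /= deriv_nodepoly_neq0.
Qed.

Lemma coprime_nodepoly_deriv : coprimep P P^`().
Proof.
rewrite {1}/nodepoly; elim/big_ind: _ => [|p q|i _]; first exact: coprime1p.
  by rewrite coprimepMl => -> ->.
by rewrite coprimep_sym coprimep_XsubC /root deriv_nodepoly_neq0.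
Qed.

(** The Wronskian has degree at most 2d - 2, the number of the nodes. *)
Lemma wronskian_nodes N M : (size N <= d.+1)%N -> (size M <= d.+1)%N ->
  W N M != 0 -> (forall i, (W N M).[c i] = 0) -> exists2 k, k != 0 & W N M = k *: P.
Proof.
move=> sN sM W0 Wc; have [e de] : exists e, d = e.+1 by exists d.-1; lia.
have sW : (size (W N M) <= (e + e).+1)%N by apply: size_wronskian; rewrite -de.
have /dvdpP[h hE] := nodepoly_dvdp c_inj Wc.
have h0 : h != 0 by apply: contraNneq W0 => h0; rewrite hE h0 mul0r.
have /size1_polyC hc : (size h <= 1)%N.
  by move: sW; rewrite hE size_Mmonic // sizeP addnS /=; lia.
by exists h`_0; [rewrite -polyC_eq0 -hc | rewrite hE {1}hc mul_polyC].
Qed.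

Lemma schwarzian_potential_cross N M : M != 0 -> W N M != 0 ->
  let U := N^`()^`() * M^`() - N^`() * M^`()^`() in
  schwarzian (N%:F / M%:F) = potential c A <->
  ((W N M * (W N M)^`()^`()) *+ 2 - ((W N M)^`() * (W N M)^`()) *+ 3
   + (U * W N M) *+ 4) * (P ^+ 2 *+ 2) = - (G *+ 3) * (W N M ^+ 2 *+ 2).
Proof.
move=> M0 W0 U; rewrite potentialE // schwarzian_wronskian ?natr_eq0_char0 //.
have two0 : 2 != 0 :> {poly F} by rewrite -polyC_natr polyC_eq0 natr_eq0_char0.
have nz (q : {poly F}) : q != 0 -> q ^+ 2 *+ 2 != 0.
  by move=> q0; rewrite -mulr_natl mulf_neq0 ?expf_neq0.
have P0 := nodepoly_neq0.
by split=> [/eqP|e]; [|apply/eqP]; rewrite frac_divE ?nz // -?e // => /eqP.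
Qed.

(** N and M are solutions of the equation det (w, N, M; w', N', M'; w'', N'', M'') = 0, in
    which the coefficient of w'' is the Wronskian and that of w' its derivative, up to sign. *)
Lemma lame_wronskian N M k : k != 0 -> W N M = k *: P ->
  let T := k^-1 *: (N^`()^`() * M^`() - N^`() * M^`()^`()) in
  lame c T N = 0 /\ lame c T M = 0.
Proof.
move=> k0 WE T; have k0P : k%:P != 0 by rewrite polyC_eq0.
have kT : k%:P * T = N^`()^`() * M^`() - N^`() * M^`()^`().
  by rewrite mul_polyC scalerA mulfV // scale1r.
have WE' : k%:P * P = W N M by rewrite WE mul_polyC.
have WE1 : k%:P * P^`() = (W N M)^`() by rewrite WE derivZ mul_polyC.
have eq0 w : W N M * w^`()^`() - (W N M)^`() * w^`()
    + (N^`()^`() * M^`() - N^`() * M^`()^`()) * w = 0 -> lame c T w = 0.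
  rewrite -WE1 -WE' -kT => e; apply: (mulfI k0P); rewrite mulr0 -[RHS]e /lame.
  by ring.
by split; apply: eq0; rewrite /wronskian !(derivB, derivM); ring.
Qed.

Lemma schwarzian_potentialP N M k : M != 0 -> k != 0 -> W N M = k *: P ->
  schwarzian (N%:F / M%:F) = potential c A <->
  potential_coef c A (k^-1 *: (N^`()^`() * M^`() - N^`() * M^`()^`())).
Proof.
move=> M0 k0 WE; have P0 := nodepoly_neq0.
have W0 : W N M != 0 by rewrite WE scaler_eq0 negb_or k0.
rewrite schwarzian_potential_cross //.
set U := N^`()^`() * M^`() - N^`() * M^`()^`(); set T := k^-1 *: U.
have UE : U = k%:P * T by rewrite mul_polyC scalerA mulfV // scale1r.
rewrite WE !derivZ UE /potential_coef; clearbody T; rewrite -!mul_polyC.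
have kP0 : (k%:P * P) ^+ 2 *+ 2 != 0.
  rewrite -mulr_natl mulf_neq0 ?expf_neq0 ?mulf_neq0 ?polyC_eq0 //.
  by rewrite -polyC_natr polyC_eq0 natr_eq0_char0.
split=> [e|e]; last first.
  transitivity (((P * P^`()^`()) *+ 2 - (P^`() * P^`()) *+ 3 + (P * T) *+ 4)
     * ((k%:P * P) ^+ 2 *+ 2)); first by ring.
  by rewrite e; ring.
apply: (mulIf kP0); apply/eqP; rewrite -subr_eq0; apply/eqP.
by move/eqP: e; rewrite -subr_eq0 => /eqP <-; ring.
Qed.

Lemma obstruction_eq0_of_solution T w i : lame c T w = 0 -> w.[c i] != 0 ->
  T.[c i] ^+ 2 - P^`()^`().[c i] * T.[c i] + P^`().[c i] * T^`().[c i] = 0.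
Proof.
move=> e wi; have e0 := congr1 (fun p : {poly F} => p.[c i]) e.
have e1 := congr1 (fun p : {poly F} => p^`().[c i]) e.
move: e0 e1; rewrite /lame !(derivB, derivD, derivM) deriv0.
rewrite !(hornerD, hornerN, hornerM) horner0 nodepoly_root !mul0r add0r => e0 e1.
apply: (mulIf wi); rewrite mul0r.
have e0' : T.[c i] * w.[c i] = P^`().[c i] * w^`().[c i].
  by apply/eqP; rewrite -subr_eq0 addrC e0.
transitivity ((T.[c i] - P^`()^`().[c i]) * (T.[c i] * w.[c i])
  + P^`().[c i] * (T^`().[c i] * w.[c i])); first by ring.
rewrite e0' -[RHS](mulr0 P^`().[c i]) -[in RHS]e1; ring.
Qed.

(** A solution that does not vanish at the node has no logarithm there. *)
Lemma L_val_lame T w i : potential_coef c A T -> lame c T w = 0 ->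
  w.[c i] != 0 -> L_val c A i = 0.
Proof.
move=> hT e wi; have := lame_obstruction c_inj i hT.
rewrite (obstruction_eq0_of_solution e wi) mulr0 => /esym/eqP.
rewrite !mulf_eq0 (negPf (deriv_nodepoly_neq0 c_inj i)).
by rewrite natr_eq0_char0 //= => /eqP.
Qed.

(** At a node the Lame equation reads P' w' = T w, which makes the vectors (w, w') of all
    solutions proportional. *)
Lemma wronskian_lame T N M i : lame c T N = 0 -> lame c T M = 0 ->
  (W N M).[c i] = 0.
Proof.
move=> eN eM; apply: (mulfI (deriv_nodepoly_neq0 c_inj i)); rewrite mulr0.
have h (w : {poly F}) : lame c T w = 0 -> P^`().[c i] * w^`().[c i] = T.[c i] * w.[c i].
  move=> /(congr1 (fun p : {poly F} => p.[c i])); rewrite /lame.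
  rewrite !(hornerD, hornerN, hornerM) horner0 nodepoly_root mul0r add0r addrC.
  by move/eqP; rewrite subr_eq0 => /eqP.
rewrite /wronskian hornerD hornerN !hornerM.
transitivity (P^`().[c i] * N^`().[c i] * M.[c i]
  - N.[c i] * (P^`().[c i] * M^`().[c i])); first by ring.
by rewrite !h //; ring.
Qed.

(** The exponents d and d - 1 at infinity are the only possible degrees. *)
Lemma size_lame_solution T w : potential_coef c A T -> (size G <= 2 * n - 2)%N ->
  lame c T w = 0 -> w != 0 -> size w = d \/ size w = d.+1.
Proof.
move=> hT sG e w0; pose s := (size w).-1.
have sw : size w = s.+1 by rewrite prednK // size_poly_gt0.
have := lame_gauge w hT; rewrite e mulr0 mul0rn => /esym/eqP.
rewrite subr_eq0 => /eqP egauge.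
have := coef_X2_gauge_top nE dgt1 Pmonic sizeP (eq_leq sw).
have n2 : (2 <= n)%N by lia.
rewrite egauge coefXnM; case: ltnP => [|_]; first by lia.
rewrite coefMn (leq_sizeP _ _ (_ : (size (G * w)%R <= n + n + s - 2)%N)) //; last first.
  by apply: leq_trans (size_polyMleq _ _) _; rewrite sw; lia.
rewrite mul0rn => /esym/eqP; rewrite !mulf_eq0 natr_eq0_char0 //=.
have -> : (w`_s == 0) = false by rewrite -lead_coefE lead_coef_eq0 (negPf w0).
rewrite orbF.
have inj (i j : nat) : i%:R = j%:R :> F -> i = j.
  wlog ij : i j / (i <= j)%N => [hw|].
    by case/orP: (leq_total i j) => h e'; [|symmetry]; apply: hw.
  move/eqP; rewrite eq_sym -subr_eq0 -natrB // natr_eq0_char0 // => ?; lia.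
case/orP => [|/eqP e1].
  by rewrite subr_eq0 => /eqP/inj sd; right; rewrite sw sd.
left; rewrite sw; apply: inj; rewrite -natr1; apply: (addIr (- d%:R)).
by rewrite addrAC e1 subrr.
Qed.

(** The difference of the degrees makes the Wronskian nonzero, hence a nonzero multiple
    of P. *)
Lemma solution_of_lame T N M : potential_coef c A T ->
  lame c T N = 0 -> lame c T M = 0 -> size N = d.+1 -> size M = d ->
  exists f, ratdeg f = d /\ schwarzian f = potential c A.
Proof.
move=> hT eN eM sN sM.
have [e de] : exists e, d = e.+1 by exists d.-1; lia.
have M0 : M != 0 by rewrite -size_poly_gt0 sM; lia.
have N0 : N != 0 by rewrite -size_poly_gt0 sN.
have W0 : W N M != 0.
  apply: contraTneq isT => W0; have := @coef_wronskian _ N M e.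
  rewrite W0 coef0 -de sN sM leqnn leqnSn => /(_ isT isT)/esym/eqP.
  rewrite [M`_d](leq_sizeP _ _ (leqnn _)) ?sM // mulr0 subr0 mulf_eq0.
  have -> : N`_d = lead_coef N by rewrite lead_coefE sN.
  have -> : M`_e = lead_coef M by rewrite lead_coefE sM de.
  by rewrite !lead_coef_eq0 (negPf N0) (negPf M0).
have [k k0 WE] : exists2 k, k != 0 & W N M = k *: P.
  apply: wronskian_nodes => //; rewrite ?sN ?sM // => i.
  exact: wronskian_lame eN eM.
have cNM : coprimep N M.
  (* The square of a common factor would divide the Wronskian, but P is squarefree. *)
  pose g := gcdp N M; have [N1 N1E] := dvdpP _ _ (dvdp_gcdl N M).
  have [M1 M1E] := dvdpP _ _ (dvdp_gcdr N M).
  rewrite -/g in N1E M1E.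
  have ggP : g * g %| P.
    rewrite -(dvdpZr _ _ k0) -WE; apply/dvdpP; exists (W N1 M1).
    by rewrite /wronskian N1E M1E !derivM; ring.
  have gP : g %| P by apply: dvdp_trans ggP; rewrite dvdp_mulr.
  have gP1 : g %| P^`().
    case/dvdpP: ggP => h ->; rewrite !derivM dvdp_add //; apply: dvdp_mull.
      exact: dvdp_mulIl.
    by rewrite dvdp_add ?dvdp_mulIl ?dvdp_mulIr.
  have : g %| gcdp P P^`() by rewrite dvdp_gcd gP.
  rewrite /coprimep -dvdp1 -/g => /dvdp_trans -> //.
  by have := coprime_nodepoly_deriv; rewrite -gcdp_eqp1 => /andP[].
exists (N%:F / M%:F); split.
  by rewrite ratdeg_coprime // sN sM /=; lia.
apply/(schwarzian_potentialP M0 k0 WE).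
suff -> : k^-1 *: (N^`()^`() * M^`() - N^`() * M^`()^`()) = T by [].
have [] := lame_wronskian k0 WE; set T' := k^-1 *: _ => eN' _.
have : (T' - T) * N = 0.
  transitivity (lame c T' N - lame c T N); first by rewrite /lame; ring.
  by rewrite eN eN' subrr.
by move/eqP; rewrite mulf_eq0 (negPf N0) orbF subr_eq0 => /eqP.
Qed.

End Solutions.

(** * From rational functions to equations, and back *)

Section Equivalences.

Variables (F : fieldType) (n d : nat).
Hypotheses (charF0 : [pchar F] =i pred0) (nE : n = (2 * d - 2)%N) (dgt1 : (1 < d)%N).
Variables (c A : 'I_n -> F).
Hypothesis c_inj : injective c.
Implicit Types (p q u v w N M T : {poly F}) (f : {fraction {poly F}}).

Local Notation P := (nodepoly c).
Local Notation G := (momentnum c A 0).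
Local Notation W := wronskian.

Let Pmonic : P \is monic := nodepoly_monic c.
Let sizeP : size P = n.+1 := size_nodepoly c.

Lemma size_leq_nodepolyM k p : (size (P * p)%R <= n + k)%N -> (size p <= k)%N.
Proof.
have [->|p0] := eqVneq p 0; first by rewrite size_poly0.
by rewrite mulrC size_Mmonic // sizeP addnS addnC /= leq_add2l.
Qed.

Lemma size_leq_mulrn4 k p : (size (p *+ 4) <= k)%N -> (size p <= k)%N.
Proof. by rewrite -scaler_nat size_scale // natr_eq0_char0. Qed.

Lemma size_potential_coef T : potential_coef c A T -> (size G <= 2 * n - 2)%N ->
  (size T <= n - 1)%N.
Proof.
move=> hT sG; apply: size_leq_nodepolyM; apply: size_leq_mulrn4; rewrite hT.
have sP1 : (size P^`() <= n)%N by apply: size_deriv_leq; rewrite sizeP.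
have sP2 : (size P^`()^`() <= n.-1)%N by apply: size_deriv_leq; rewrite prednK //; lia.
have b p q : (size p + size q <= n + n)%N -> (size (p * q)%R <= n + (n - 1))%N.
  by move=> h; apply: leq_trans (size_polyMleq _ _) _; lia.
have h1 : (size (P^`() * P^`())%R <= n + (n - 1))%N by apply: b; apply: leq_add.
have h2 : (size (P * P^`()^`())%R <= n + (n - 1))%N by apply: b; rewrite sizeP; lia.
have hG : (size G <= n + (n - 1))%N by apply: leq_trans sG _; lia.
by rewrite size_polyD_leq ?size_polyN ?size_natmul_leq // size_polyD_leq
  ?size_polyN ?size_natmul_leq.
Qed.

(** E_3 = 0 lowers the degree of the image by one more than the exponent d does. *)
Lemma size_lame T w : potential_coef c A T -> (size G <= 2 * n - 3)%N ->
  (size w <= d.+1)%N -> (size (lame c T w) <= n + d - 3)%N.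
Proof.
move=> hT sG sw; apply: size_leq_nodepolyM; apply: size_leq_mulrn4; rewrite (lame_gauge _ hT).
have hgauge : (size (gauge P w) <= n + (n + d - 3))%N.
  by apply: leq_trans (size_gauge nE dgt1 Pmonic sizeP sw) _; lia.
have hG : (size (G * w)%R <= n + (n + d - 3))%N.
  by apply: leq_trans (size_polyMleq _ _) _; lia.
by rewrite size_polyD_leq ?size_polyN ?size_natmul_leq.
Qed.

(** If the Wronskian did not vanish at c_i, the Schwarzian derivative would have no
    pole there. *)
Lemma solution_wronskian f : ratdeg f = d -> schwarzian f = potential c A ->
  exists2 k, k != 0 & W (ratnum f) (ratden f) = k *: P.
Proof.
move=> df Sf; have cNM := coprime_ratnum_ratden f; have M0 := ratden_neq0 f.
rewrite (ratnum_ratdenE f) in Sf; move: df M0 cNM Sf; rewrite /ratdeg.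
move: (ratnum f) (ratden f) => N M df M0 cNM Sf.
have W0 : W N M != 0 by apply: wronskian_neq0 => //; rewrite ?df.
apply: (wronskian_nodes nE dgt1 c_inj) => // [||i]; try by lia.
have /(congr1 (fun p : {poly F} => p.[c i])) := (schwarzian_potential_cross charF0 A c_inj M0 W0).1 Sf.
rewrite !(horner_exp, hornerMn, hornerM, hornerN) nodepoly_root.
rewrite expr0n /= mul0rn mulr0 => /esym/eqP.
have nz (x : F) m : (x *+ m.+1 == 0) = (x == 0).
  by rewrite -mulr_natl mulf_eq0 natr_eq0_char0.
rewrite potnum_node mulf_eq0 oppr_eq0 !nz.
by rewrite !expf_eq0 /= (negPf (deriv_nodepoly_neq0 c_inj i)) /= => /eqP.
Qed.

Lemma solution_lame f : ratdeg f = d -> schwarzian f = potential c A ->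
  exists T, [/\ potential_coef c A T, lame c T (ratnum f) = 0 & lame c T (ratden f) = 0].
Proof.
move=> df Sf; have [k k0 WE] := solution_wronskian df Sf.
eexists; split; last 2 first.
- exact: (lame_wronskian k0 WE).1.
- exact: (lame_wronskian k0 WE).2.
by apply/(schwarzian_potentialP charF0 A c_inj (ratden_neq0 f) k0 WE); rewrite -ratnum_ratdenE.
Qed.

Lemma solution_L_val f i : ratdeg f = d -> schwarzian f = potential c A ->
  L_val c A i = 0.
Proof.
move=> df Sf; have [T [hT eN eM]] := solution_lame df Sf.
have [rM|rM] := boolP (root (ratden f) (c i)); last exact: L_val_lame hT eM rM.
apply: (L_val_lame _ _ hT eN) => //.
apply: contraTneq rM => rN; apply: (coprimep_root (coprime_ratnum_ratden f)).
by apply/rootP.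
Qed.

(** A solution of degree d leaves no room for E_3: the gauge terms of
    the Lame equation have degree at most 2n + d - 4, and so does the product of the
    numerator of the potential with the solution. *)
Lemma solution_E_succ f m : ratdeg f = d -> schwarzian f = potential c A ->
  (m <= 2)%N -> E_succ c A m = 0.
Proof.
move=> df Sf m2; have [T [hT eN eM]] := solution_lame df Sf.
have [w sw ew] : exists2 w : {poly F}, size w = d.+1 & lame c T w = 0.
  move: df; rewrite /ratdeg.
  case: (leqP (size (ratden f)).-1 (size (ratnum f)).-1) => _ df.
    by exists (ratnum f) => //; lia.
  by exists (ratden f) => //; lia.
have h3 : (3 <= 2 * n)%N by lia.
apply/(size_potnumP A c_inj h3); last by [].
have w0 : w != 0 by rewrite -size_poly_gt0 sw.
have := lame_gauge w hT; rewrite ew mulr0 mul0rn => /esym/eqP.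
rewrite subr_eq0 => /eqP egauge.
have := size_gauge nE dgt1 Pmonic sizeP (eq_leq sw); rewrite egauge.
rewrite -scaler_nat size_scale ?natr_eq0_char0 // size_mul ?(potnum_neq0 nE dgt1) //.
rewrite sw addnS /= (_ : n + n + d - 3 = 2 * n - 3 + d)%N ?leq_add2r //.
by lia.
Qed.

Lemma solution_critical f : ratdeg f = d -> schwarzian f = potential c A ->
  (forall i, simple_critical_point f (c i)) /\ regular_at_infinity f.
Proof.
move=> df Sf; have [k k0 WE] := solution_wronskian df Sf; split=> [i|].
  rewrite /simple_critical_point {1}[f]ratnum_ratdenE crit_mult_wronskian ?ratden_neq0 //.
    rewrite WE -mul_polyC mupMr ?rootC // (nodepolyE c i) mupMl ?conodepoly_neq0 //.
    by have := mup_XsubCX 1 (c i) (c i); rewrite eqxx.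
  apply/nandP; case: (boolP (root (ratnum f) (c i))); [|by left].
  by move/(coprimep_root (coprime_ratnum_ratden f)); right.
have [e de] : exists e, d = e.+1 by exists d.-1; lia.
apply: (@regular_at_infinity_wronskian _ _ e).
- by move: df; rewrite /ratdeg; lia.
- by move: df; rewrite /ratdeg; lia.
rewrite WE coefZ mulf_neq0 // (_ : e + e = n)%N; last by lia.
by rewrite leadP // oner_neq0.
Qed.

(** A nonzero solution has degree d or d - 1; so its degree is d - 1 if its
    coefficient of degree d vanishes, and d if that of degree d - 1 does. *)
Lemma solution_of_lame_coef_eq0 T : potential_coef c A T -> (size G <= 2 * n - 2)%N ->
  (forall j, exists w, [/\ w != 0, lame c T w = 0 & w`_j = 0]) ->
  exists f, ratdeg f = d /\ schwarzian f = potential c A.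
Proof.
move=> hT sG sol.
have szs := size_lame_solution charF0 nE dgt1 hT sG.
have lead w k : size w = k.+1 -> w`_k != 0.
  move=> sw; have -> : w`_k = lead_coef w by rewrite lead_coefE sw.
  by rewrite lead_coef_eq0 -size_poly_gt0 sw.
have [N [N0 eN Nd1]] := sol d.-1; have [M [M0 eM Md]] := sol d.
apply: (solution_of_lame charF0 nE dgt1 c_inj hT eN eM).
  case: (szs _ eN N0) => // sN; have := lead N d.-1.
  by rewrite prednK ?Nd1 ?eqxx ?sN => [/(_ erefl)|]; lia.
by case: (szs _ eM M0) => // /lead; rewrite Md eqxx.
Qed.

Lemma obstruction_eq0_of_L_val T i : potential_coef c A T -> L_val c A i = 0 ->
  T.[c i] ^+ 2 - P^`()^`().[c i] * T.[c i] + P^`().[c i] * T^`().[c i] = 0.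
Proof.
move=> hT Li; have := lame_obstruction c_inj i hT; rewrite Li mulr0 => /eqP.
by rewrite mulf_eq0 natr_eq0_char0 //= => /eqP.
Qed.

(** The unknown w has degree at most n + 1, and its image under the Lame operator has
    degree less than 2n, twice the number of nodes. *)
Lemma solution_of_L_val : (forall i, L_val c A i = 0) ->
  (forall m, (m <= 1)%N -> E_succ c A m = 0) ->
  exists f, ratdeg f = d /\ schwarzian f = potential c A.
Proof.
move=> hL hE; have [T hT] := exists_potential_coef charF0 A c_inj.
have h2 : (2 <= 2 * n)%N by lia.
have sG : (size G <= 2 * n - 2)%N by apply/(size_potnumP A c_inj h2).
apply: (solution_of_lame_coef_eq0 hT sG) => j.
pose s := [seq c i | i <- enum 'I_n].
have ss : size s = n by rewrite size_map size_enum_ord.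
have us : uniq s by rewrite map_inj_uniq // enum_uniq.
have lameE w : P * w^`()^`() + - P^`() * w^`() + T * w = lame c T w.
  by rewrite mulNr.
have [|x|w|w [w0 _]] := @exists_poly_operator_eq0 _ s P (- P^`()) T (coefp j) us.
- by move=> a p q; rewrite linearP.
- case/mapP=> i _ ->; rewrite derivN !hornerN nodepoly_root oppr_eq0 subrr.
  rewrite deriv_nodepoly_neq0 //; split=> //.
  apply/eqP; rewrite -subr_eq0; apply/eqP.
  by rewrite -[RHS](obstruction_eq0_of_L_val hT (hL i)); ring.
- rewrite lameE ss => sw.
  have sT := size_potential_coef hT sG.
  have sw1 := size_deriv_leq sw; have sw2 := size_deriv_leq sw1.
  have sP1 : (size P^`() <= n)%N by apply: size_deriv_leq; rewrite sizeP.
  rewrite /lame !size_polyD_leq ?size_polyN //.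
  + by apply: (size_polyM_leq _ sw2); [exact: eq_leq sizeP | lia].
  + by apply: (size_polyM_leq sP1 sw1); lia.
  by apply: (size_polyM_leq sT sw); lia.
by rewrite lameE => ew wj; exists w.
Qed.

End Equivalences.

(** * A node in the role of infinity *)

Section PoleAtNode.

Variables (F : fieldType) (n d : nat).
Hypotheses (charF0 : [pchar F] =i pred0) (nE : n = (2 * d - 2)%N) (dgt1 : (1 < d)%N).
Variables (c A : 'I_n -> F).
Hypothesis c_inj : injective c.
Variable k : 'I_n.
Implicit Types (p q u v w T : {poly F}).

Local Notation P := (nodepoly c).
Local Notation Pk := (conodepoly c k).
Local Notation G := (momentnum c A 0).
Local Notation t := ('X - (c k)%:P).

(** This is t^(m+1) times the image of u / t^m under the Lame operator, a polynomial
    because P is divisible by t. *)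
Definition lame_pole m T u : {poly F} :=
  P * t * u^`()^`() + - (P *+ (2 * m) + P^`() * t) * u^`()
  + (Pk *+ (m * m.+1) + P^`() *+ m + T * t) * u.

Lemma lame_poleD m T u v : lame_pole m T (u + v) = lame_pole m T u + lame_pole m T v.
Proof. by rewrite /lame_pole !derivD; ring. Qed.

Lemma lame_poleS m T v : lame_pole m.+1 T (t * v) = t * lame_pole m T v.
Proof.
rewrite /lame_pole (nodepolyE c k) !(derivXsubC, derivM, derivD, derivC).
by ring.
Qed.

Lemma lame_pole_exp m T w : lame_pole m T (t ^+ m * w) = t ^+ m.+1 * lame c T w.
Proof.
elim: m => [|m IHm]; first by rewrite mul1r /lame_pole /lame expr1; ring.
by rewrite exprS -mulrA lame_poleS IHm mulrA -exprS.
Qed.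

(** The exponents 0 and 2 at a node are nonnegative, so a solution cannot have a
    pole there. *)
Lemma lame_pole_eq0 m T u : lame_pole m T u = 0 ->
  exists2 w, u = t ^+ m * w & lame c T w = 0.
Proof.
have t0 : t != 0 by rewrite polyXsubC_eq0.
elim: m u => [|m IHm] u e.
  exists u; first by rewrite expr0 mul1r.
  by apply: (mulfI t0); rewrite mulr0 -[RHS]e -(lame_pole_exp 0) mul1r.
have uk : u.[c k] = 0.
  have := congr1 (fun p : {poly F} => p.[c k]) e.
  rewrite /lame_pole !(hornerMn, hornerD, hornerM, hornerN, hornerX, hornerC).
  rewrite nodepoly_root deriv_nodepoly ?horner0 subrr => e'.
  have /eqP : (m.+1 * m.+3)%:R * (Pk.[c k] * u.[c k]) = 0.
    by rewrite -[RHS]e'; ring.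
  rewrite !mulf_eq0 natr_eq0_char0 // (negPf (conodepoly_neq0 c_inj k)) /=.
  by move/eqP.
have /factor_theorem[v vE] : root u (c k) by apply/rootP.
rewrite vE mulrC lame_poleS in e; move/eqP: e; rewrite mulf_eq0 (negPf t0) /=.
move/eqP/IHm => [w wE ew]; exists w => //.
by rewrite vE wE mulrC mulrA -exprS.
Qed.

(** The count is on the polynomials u = t^(d-2) w of degree at most n, with the n - 1 other
    nodes. *)
Lemma solution_of_L_val_but_one : (forall i, i != k -> L_val c A i = 0) ->
  (forall m, (m <= 2)%N -> E_succ c A m = 0) ->
  exists f, ratdeg f = d /\ schwarzian f = potential c A.
Proof.
move=> hL hE; have [T hT] := exists_potential_coef charF0 A c_inj.
have h3 : (3 <= 2 * n)%N by lia.
have sG : (size G <= 2 * n - 3)%N by apply/(size_potnumP A c_inj h3).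
have sG2 : (size G <= 2 * n - 2)%N by apply: leq_trans sG _; lia.
apply: (solution_of_lame_coef_eq0 charF0 nE dgt1 c_inj hT sG2) => j.
have tm0 : t ^+ (d - 2) != 0 by rewrite expf_neq0 ?polyXsubC_eq0.
pose s := [seq c i | i <- enum [pred i | i != k]].
have ss : size s = (n - 1)%N.
  by rewrite size_map -cardE cardC1 card_ord subn1.
have us : uniq s by rewrite map_inj_uniq // enum_uniq.
pose phi u := (u %/ t ^+ (d - 2))`_j.
have phi_lin : scalar phi.
  by move=> a p q; rewrite /phi divpD divpZl coefD coefZ.
have [x|u|u [u0 _]] := exists_poly_operator_eq0 (a := P * t)
    (b := - (P *+ (2 * (d - 2)) + P^`() * t))
    (e := Pk *+ ((d - 2) * (d - 2).+1) + P^`() *+ (d - 2) + T * t) us phi_lin.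
- case/mapP=> i; rewrite mem_enum => ik ->.
  have tau0 : c i - c k != 0 by rewrite subr_eq0; apply: contra ik => /eqP/c_inj ->.
  have Pki : Pk.[c i] = 0.
    apply: (mulfI tau0); have := nodepoly_root c i.
    by rewrite (nodepolyE c k) hornerM hornerXsubC mulr0.
  have P1i : P^`().[c i] = (c i - c k) * Pk^`().[c i].
    rewrite (nodepolyE c k) derivM derivXsubC hornerD !hornerM hornerXsubC.
    by rewrite Pki mulr0 add0r.
  have ob := obstruction_eq0_of_L_val charF0 c_inj hT (hL i ik).
  have p0 := deriv_nodepoly_neq0 c_inj i.
  rewrite !(derivMn, derivN, derivD, derivM, derivC, derivX).
  rewrite !(hornerMn, hornerN, hornerD, hornerM, hornerC, hornerX).
  rewrite nodepoly_root Pki; split; try by ring.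
    rewrite mul0rn add0r oppr_eq0 mulf_neq0 //.
  apply/eqP; rewrite -subr_eq0; apply/eqP.
  set m := (d - 2)%N; set tau := c i - c k in P1i *.
  transitivity (tau ^+ 2 * (T.[c i] ^+ 2 - P^`()^`().[c i] * T.[c i]
      + P^`().[c i] * T^`().[c i])
    + (tau * Pk^`().[c i] - P^`().[c i]) * P^`().[c i] *+ (m * m.+1)).
    by rewrite /tau; ring.
  by rewrite ob mulr0 -P1i subrr mul0r mul0rn addr0.
- rewrite ss => su; rewrite -/(lame_pole (d - 2) T u).
  have d2 : (2 * (n - 1) = n + 2 * (d - 2))%N by lia.
  (* E_3 = 0 lowers the degree on the multiples of t^(d-2), where the operator is the Lame
     operator; the remainder has a small degree anyway. *)
  rewrite (divp_eq u (t ^+ (d - 2))) lame_poleD mulrC lame_pole_exp.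
  apply: size_polyD_leq.
    apply: (@size_polyM_leq _ _ (d - 2).+2 (n + d - 3)); last by lia.
      by rewrite size_exp_XsubC; lia.
    apply: (size_lame charF0 nE dgt1 hT sG).
    by rewrite size_divp // size_exp_XsubC; apply: leq_trans (leq_sub2r _ su) _; lia.
  set r := _ %% _; have sr : (size r <= d - 2)%N.
    by rewrite -ltnS -(size_exp_XsubC (d - 2) (c k)) ltn_modpN0.
  have [r0|r0] := eqVneq r 0.
    by rewrite r0 /lame_pole !deriv0 !mulr0 !addr0 size_poly0.
  have sr0 : (0 < size r)%N by rewrite size_poly_gt0.
  have sP : (size P <= n.+1)%N by rewrite size_nodepoly.
  have sP1 := size_deriv_leq sP.
  have st : (size t <= 2)%N by rewrite size_XsubC.
  have sr1 : (size r^`() <= d - 3)%N by apply: size_deriv_leq; apply: leq_trans sr _; lia.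
  have sr2 : (size r^`()^`() <= d - 3)%N.
    by apply: size_deriv_leq; apply: leq_trans sr1 _; lia.
  have sT := size_potential_coef charF0 nE dgt1 hT sG2.
  have sPt : (size (P * t)%R <= n.+2)%N by apply: (size_polyM_leq sP st); lia.
  have sP1t : (size (P^`() * t)%R <= n.+1)%N by apply: (size_polyM_leq sP1 st); lia.
  have sTt : (size (T * t)%R <= n)%N by apply: (size_polyM_leq sT st); lia.
  have sPk : (size Pk <= n)%N by rewrite size_conodepoly.
  rewrite /lame_pole !size_polyD_leq //.
  + by apply: (size_polyM_leq sPt sr2); lia.
  + apply: (@size_polyM_leq _ _ n.+1 _ _ _ _ sr1); last by lia.
    by rewrite size_polyN size_polyD_leq ?size_natmul_leq.
  apply: (@size_polyM_leq _ _ n _ _ _ _ sr); last by lia.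
  by rewrite !size_polyD_leq ?size_natmul_leq.
rewrite -/(lame_pole (d - 2) T u) => /lame_pole_eq0[w uE ew] uj; exists w; split=> //.
  by apply: contraNneq u0 => w0; rewrite uE w0 mulr0.
by rewrite -[RHS]uj /phi uE mulKp.
Qed.

End PoleAtNode.

Theorem theorem1p2 (R : realType) (d : nat) (hd : (2 <= d)%N)
    (c : 'I_(2 * d - 2) -> R[i]) (hc : injective c)
    (A : 'I_(2 * d - 2) -> R[i]) :
  let P1 := exists f : {fraction {poly R[i]}},
    ratdeg f = d /\ schwarzian f = potential c A in
  let P2 := (forall i : 'I_(2 * d - 2), L_val c A i = 0) /\
    (forall m : nat, (m <= 2)%N -> E_succ c A m = 0) in
  let P3 := (forall i : 'I_(2 * d - 2), (i < 2 * d - 3)%N -> L_val c A i = 0) /\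
    (forall m : nat, (m <= 2)%N -> E_succ c A m = 0) in
  let P4 := (forall i : 'I_(2 * d - 2), L_val c A i = 0) /\
    (forall m : nat, (m <= 1)%N -> E_succ c A m = 0) in
  [/\ P1 <-> P2, P1 <-> P3, P1 <-> P4 &
      forall f : {fraction {poly R[i]}},
        ratdeg f = d -> schwarzian f = potential c A ->
        (forall i : 'I_(2 * d - 2), simple_critical_point f (c i)) /\
        regular_at_infinity f].
Proof.
move=> P1 P2 P3 P4; have char0 : [pchar R[i]] =i pred0 by apply: Num.Theory.pchar_num.
have P12 : P1 -> P2.
  case=> f [df Sf]; split=> [i|m m2].
    exact: (solution_L_val char0 erefl hd hc i df Sf).
  exact: (solution_E_succ char0 erefl hd hc df Sf m2).
have P31 : P3 -> P1.
  case=> hL hE; have lastP : (2 * d - 3 < 2 * d - 2)%N by lia.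
  apply: (solution_of_L_val_but_one char0 erefl hd hc (k := Ordinal lastP)) => // i.
  move=> ik; apply: hL; have := ltn_ord i.
  by move: ik; rewrite -val_eqE /=; lia.
have P41 : P4 -> P1 by case=> hL hE; apply: (solution_of_L_val char0 erefl hd hc).
split; last by move=> f df Sf; apply: (solution_critical char0 erefl hd hc df Sf).
- by split=> // -[hL hE]; apply: P31; split.
- by split=> // /P12[hL hE]; split.
by split=> // /P12[hL hE]; split=> // m m1; apply: hE; apply: leqW.
Qed.
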